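(* Let $r\ge 2$ and let $(\rho_i)_{i=1}^r$ be a tuple of pairwise commuting quantum states. Let $(\rho_i(x))_x$ denote the eigenvalues of $\rho_i$ in a common eigenbasis of $\rho_1,\dots,\rho_r$. Define the average pairwise fidelity $F(\rho_1,\ldots,\rho_r)=\frac{2}{r(r-1)}\sum_{i<j}\sum_x\sqrt{\rho_i(x)\rho_j(x)}$ and the Matusita fidelity $F_r(\rho_1,\ldots,\rho_r)=\sum_x\left(\rho_1(x)\cdots\rho_r(x)\right)^{1/r}$. Then $$F(\rho_1,\ldots,\rho_r)\ \ge\ F_r(\rho_1,\ldots,\rho_r).$$
   Context: A quantum state is a positive semi-definite operator of unit trace on a finite-dimensional complex Hilbert space; all states in the tuple act on the same space. Sums over $i<j$ are over $1\le i<j\le r$. *)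

(* Defs.v *)
From mathcomp Require Import all_boot all_order all_algebra.
From mathcomp Require Import complex reals.

Set Implicit Arguments.
Unset Strict Implicit.
Unset Printing Implicit Defensive.

Import Order.TTheory GRing.Theory Num.Theory.
Local Open Scope ring_scope.
Local Open Scope complex_scope.
Local Open Scope sesquilinear_scope.

Section States.
Variables (R : realType) (d : nat).
Local Notation C := R[i].

(* Operators on the Hilbert space C^d act on column vectors. In the order of
   C, [0 <= z] means that z is real and nonnegative. *)
Definition psd (A : 'M[C]_d) : Prop :=
  A \is hermsymmx /\ forall v : 'cV[C]_d, 0 <= (v ^t* *m A *m v) 0 0.

Definition quantum_state (rho : 'M[C]_d) : Prop := psd rho /\ \tr rho = 1.

(* The columns of [V] form a basis of C^d, not necessarily orthonormal, and
   the x-th one is an eigenvector of every [rho i], with eigenvalue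
   [ev i x]. *)
Definition common_eigenbasis (r : nat) (rho : 'I_r -> 'M[C]_d)
    (V : 'M[C]_d) (ev : 'I_r -> 'I_d -> C) : Prop :=
  V \in unitmx /\
  forall (i : 'I_r) (x : 'I_d), rho i *m col x V = ev i x *: col x V.

(* [sqrtC] and [r.-root] are total on C; at a nonnegative real they return the
   nonnegative real root. *)
Definition avg_pairwise_fidelity (r : nat) (ev : 'I_r -> 'I_d -> C) : C :=
  2 / (r%:R * (r%:R - 1)) *
  \sum_(i < r) \sum_(j < r | (i < j)%N) \sum_(x < d) sqrtC (ev i x * ev j x).

Definition matusita_fidelity (r : nat) (ev : 'I_r -> 'I_d -> C) : C :=
  \sum_(x < d) r.-root (\prod_(i < r) ev i x).

(* Both fidelities are thus defined for every tuple of commuting states. *)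
Lemma common_eigenbasis_exists (r : nat) (rho : 'I_r -> 'M[C]_d) :
  (forall i, quantum_state (rho i)) ->
  (forall i j, comm_mx (rho i) (rho j)) ->
  exists V ev, common_eigenbasis rho V ev.
Proof.
move=> rho_st rhoC; pose As := [seq rho i | i : 'I_r].
have /codiagonalizableP[P Pu /allP PAs] :
    {in As &, forall A B, comm_mx A B} /\ {in As, forall A, diagonalizable A}.
  split=> [A B /mapP[i _ ->] /mapP[j _ ->]|A /mapP[i _ ->]]; first exact: rhoC.
  have [[/hermitian_normalmx/orthomx_spectralP rhoE _] _] := rho_st i.
  exists (spectralmx (rho i)); first exact: spectral_unit.
  apply/diagonalizable_forPex; exists (spectral_diag (rho i)).
  apply/(simmxP (spectral_unit _)).
  by rewrite {2}rhoE !mulmxA mulmxV ?mul1mx ?spectral_unit.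
exists (invmx P), (fun i x => (P *m rho i *m invmx P) x x).
split=> [|i x]; first by rewrite unitmx_inv.
have iAs : rho i \in As by apply: map_f; rewrite mem_enum.
have /diagonalizable_forPex[D /(simmxRL Pu) DE] := PAs _ iAs.
have rhoV : rho i *m invmx P = invmx P *m diag_mx D.
  by rewrite DE !mulmxA mulVmx ?mul1mx.
rewrite -DE colE mulmxA rhoV mul_mx_diag.
by apply/matrixP=> k l; rewrite -!colE !mxE eqxx mulrC.
Qed.

End States.

(* Main.v *)
(* Each eigenvalue is nonnegative, being a Rayleigh quotient at a column of
   [V].  At a fixed x, apply AM-GM to the r(r-1) products a_i a_j over ordered
   pairs i <> j, where a_i = sqrt(rho_i(x)): every a_i occurs 2(r-1) times, so
   the product of all of them is (prod_i rho_i(x))^(r-1), whose r(r-1)-th root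
   is the Matusita term. *)
Require Import Defs.
From mathcomp Require Import all_boot all_order all_algebra.
From mathcomp Require Import complex reals.
Import Order.TTheory GRing.Theory Num.Theory.
Local Open Scope ring_scope.
Local Open Scope complex_scope.

Lemma psd_eigenvalue_ge0 (R : realType) (d : nat) (A : 'M[R[i]]_d)
    (v : 'cV[R[i]]_d) (a : R[i]) :
  psd A -> v != 0 -> A *m v = a *: v -> 0 <= a.
Proof.
move=> [_ A_ge0] v_neq0 Av; have := A_ge0 v.
have v_gt0 : 0 < (map_mx Num.conj v^T *m v) 0 0.
  have term_ge0 (k : 'I_d) : true -> 0 <= `|v k 0| ^+ 2.
    by rewrite exprn_ge0.
  (* The squared norm is a sum of squared moduli, so it vanishes only if every coordinate does. *)
  have -> : (map_mx Num.conj v^T *m v) 0 0 = \sum_k `|v k 0| ^+ 2.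
    by rewrite mxE; apply: eq_bigr => k _; rewrite !mxE normCK mulrC.
  rewrite lt_neqAle sumr_ge0 // andbT eq_sym psumr_eq0 //.
  apply: contra v_neq0 => /allP v0; apply/eqP/colP => k; rewrite mxE.
  by have := v0 k (mem_index_enum k); rewrite sqrf_eq0 normr_eq0 => /eqP.
by rewrite -mulmxA Av -scalemxAr mxE pmulr_lge0.
Qed.

Lemma common_eigenbasis_ge0 (R : realType) (d r : nat)
    (rho : 'I_r -> 'M[R[i]]_d) (V : 'M[R[i]]_d) (ev : 'I_r -> 'I_d -> R[i]) :
  (forall k, psd (rho k)) -> common_eigenbasis rho V ev ->
  forall k x, 0 <= ev k x.
Proof.
move=> rho_psd [Vu evP] k x.
apply: psd_eigenvalue_ge0 (rho_psd k) _ (evP k x).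
(* A zero column of [V] would make column [x] of [invmx V *m V = 1] zero, yet its diagonal entry is
   1. *)
apply/eqP => Vx0; have := mulVmx Vu; move/(congr1 (col x)).
rewrite colE -mulmxA -colE Vx0 mulmx0 => /colP/(_ x)/eqP.
by rewrite !mxE eqxx eq_sym oner_eq0.
Qed.

Lemma sum_neq_sym (V : nmodType) (r : nat) (f : 'I_r -> 'I_r -> V) :
  (forall i j, f i j = f j i) ->
  \sum_(p : 'I_r * 'I_r | p.1 != p.2) f p.1 p.2 =
  (\sum_(i < r) \sum_(j < r | (i < j)%N) f i j) *+ 2.
Proof.
move=> fC; rewrite -(pair_big_dep xpredT (fun i j => i != j)) /= mulr2n.
(* Exchanging the sums in one of the two copies turns it into the sum of [f j i] over [j < i], the
   half of the off-diagonal pairs that the other copy misses. *)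
rewrite [X in _ + X](exchange_big_dep xpredT) //= -big_split /=.
apply: eq_bigr => i _; rewrite (bigID (fun j : 'I_r => (i < j)%N)) /=.
congr (_ + _); first by apply: eq_bigl => j; rewrite -val_eqE neq_ltn; case: ltngtP.
under [RHS]eq_bigr do rewrite fC.
by apply: eq_bigl => j; rewrite -val_eqE neq_ltn; case: ltngtP.
Qed.

(** Each index is the first component of [r.-1] pairs and the second component of as many. The
    square is kept innermost so that it cancels when [a i] is a square root. *)
Lemma prod_neq_pairs (R : comPzSemiRingType) (r : nat) (a : 'I_r -> R) :
  \prod_(p : 'I_r * 'I_r | p.1 != p.2) (a p.1 * a p.2) =
  \prod_(i < r) a i ^+ 2 ^+ r.-1.
Proof.
have prod_fst : \prod_(p : 'I_r * 'I_r | p.1 != p.2) a p.1 =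
                \prod_(i < r) a i ^+ r.-1.
  rewrite -(pair_big_dep xpredT (fun i j => i != j) (fun i _ => a i)) /=.
  apply: eq_bigr => i _; rewrite prodr_const; congr (_ ^+ _).
  by rewrite -[r in RHS]card_ord -(cardC1 i); apply: eq_card => j;
     rewrite !inE eq_sym.
(* Swapping coordinates preserves the off-diagonal pairs and reduces the product of second
   components to [prod_fst]. *)
have swap_inj : injective (fun p : 'I_r * 'I_r => (p.2, p.1)).
  by move=> [i j] [k l] [-> ->].
rewrite big_split /= [X in _ * X](reindex_inj swap_inj) /=.
under [X in _ * X]eq_bigl do rewrite eq_sym.
by rewrite prod_fst -big_split /=; apply: eq_bigr => i _; rewrite -expr2 exprAC.
Qed.

Lemma card_neq_pairs (r : nat) :
  #|[pred p : 'I_r * 'I_r | p.1 != p.2]| = (r * r.-1)%N.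
Proof.
rewrite -sum1_card -(pair_big_dep xpredT (fun i j => i != j) (fun _ _ => 1%N)).
rewrite /= -[X in (X * _)%N]card_ord -sum_nat_const; apply: eq_bigr => i _.
rewrite sum1_card -[r in RHS]card_ord -(cardC1 i).
by apply: eq_card => j; rewrite !inE eq_sym.
Qed.

Lemma rootC_prod_le_avg_pairs (C : numClosedFieldType) (r : nat)
    (p : 'I_r -> C) :
  (2 <= r)%N -> (forall i, 0 <= p i) ->
  r.-root (\prod_(i < r) p i) <=
  2 / (r%:R * (r%:R - 1)) *
  \sum_(i < r) \sum_(j < r | (i < j)%N) sqrtC (p i * p j).
Proof.
move=> r_ge2 p_ge0; have r_gt0 : (0 < r)%N by apply: ltnW.
have n_gt0 : (0 < r * r.-1)%N by case: r r_ge2 {p p_ge0 r_gt0} => [|[]].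
have prod_ge0 : 0 <= \prod_(i < r) p i by apply: prodr_ge0.
pose A := [pred q : 'I_r * 'I_r | q.1 != q.2].
pose E (q : 'I_r * 'I_r) := sqrtC (p q.1 * p q.2).
have E_ge0 : {in A, forall q, 0 <= E q}.
  by move=> q _; rewrite sqrtC_ge0 mulr_ge0.
(* This form of AM-GM has no root: the product is at most the mean raised to the number of pairs. *)
have [] := leif_AGM E_ge0; rewrite card_neq_pairs => AGM _.
have prodE : \prod_(q in A) E q = r.-root (\prod_(i < r) p i) ^+ (r * r.-1).
  rewrite exprM rootCK // -prodrXl.
  under eq_bigr do rewrite /E rootCMl //.
  rewrite (prod_neq_pairs _ _ (fun i => sqrtC (p i))).
  by apply: eq_bigr => i _; rewrite sqrtCK.
have sumE : \sum_(q in A) E q =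
    (\sum_(i < r) \sum_(j < r | (i < j)%N) sqrtC (p i * p j)) *+ 2.
  by apply: (sum_neq_sym _ _ (fun i j => sqrtC (p i * p j))) => i j; rewrite mulrC.
have -> : r%:R * (r%:R - 1) = (r * r.-1)%:R :> C.
  by rewrite natrM -subn1 natrB.
(* Both sides are now powers with the positive exponent [r * r.-1], so the nonnegative bases compare
   the same way. *)
move: AGM; rewrite prodE sumE ler_pXn2r ?nnegrE ?rootC_ge0 //.
  by rewrite [2 / _ * _]mulrAC mulr_natl.
by rewrite divr_ge0 // mulrn_wge0 // sumr_ge0 // => i _; rewrite sumr_ge0 // => j _;
   rewrite sqrtC_ge0 mulr_ge0.
Qed.

Theorem mainTheorem1 (R : realType) (d r : nat) (rho : 'I_r -> 'M[R[i]]_d)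
    (V : 'M[R[i]]_d) (ev : 'I_r -> 'I_d -> R[i]) :
  (2 <= r)%N ->
  (forall i : 'I_r, quantum_state (rho i)) ->
  (forall i j : 'I_r, comm_mx (rho i) (rho j)) ->
  common_eigenbasis rho V ev ->
  avg_pairwise_fidelity ev >= matusita_fidelity ev.
Proof.
move=> r_ge2 rho_st _ evP.
have ev_ge0 := common_eigenbasis_ge0 _ _ _ _ _ _ (fun k => proj1 (rho_st k)) evP.
rewrite /avg_pairwise_fidelity /matusita_fidelity.
(* Two exchanges bring the sum over [x] outermost, so the comparison can be made for each [x]
   separately. *)
under [X in _ <= _ * X]eq_bigr do rewrite exchange_big /=.
rewrite exchange_big /= mulr_sumr; apply: ler_sum => x _.
exact: (rootC_prod_le_avg_pairs _ _ (ev^~ x)).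
Qed.
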